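(* For all integers $n\geq 0$, $j\geq 1$ and every $x\in\mathbb{C}$, \[ \sum_{k=0}^n \binom{n}{k} L_{jk}\,(\sqrt{5}F_j)^{n-k} E_{n-k}(x) = 2\bigl((\sqrt{5}x+\beta)F_j + F_{j-1}\bigr)^{n} \] and \[ \sum_{k=0}^n \binom{n}{k} L_{jk}\,(-\sqrt{5}F_j)^{n-k} E_{n-k}(x) = 2\bigl((\alpha - \sqrt{5}x)F_j + F_{j-1}\bigr)^{n}. \]
   Context: $F_n$ and $L_n$ are the Fibonacci and Lucas numbers ($F_0=0,F_1=1$, $L_0=2,L_1=1$, $u_n=u_{n-1}+u_{n-2}$). $\alpha=(1+\sqrt5)/2$ and $\beta=(1-\sqrt5)/2$. Euler polynomials $E_n(x)$ are defined by $\sum_{n\geq 0} E_n(x)\frac{z^n}{n!}=\frac{2e^{xz}}{e^z+1}$. *)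

(* Defs.v *)
From HB Require Import structures.
From mathcomp Require Import all_boot all_order all_algebra.
From mathcomp Require Import reals complex.
Set Implicit Arguments.
Unset Strict Implicit.
Unset Printing Implicit Defensive.
Import Order.TTheory GRing.Theory Num.Theory.
Local Open Scope ring_scope.
Local Open Scope complex_scope.

Fixpoint fib (n : nat) : nat :=
  if n is n1.+1 then if n1 is n2.+1 then (fib n1 + fib n2)%N else 1%N else 0%N.

Fixpoint lucas (n : nat) : nat :=
  if n is n1.+1 then if n1 is n2.+1 then (lucas n1 + lucas n2)%N else 1%N
  else 2%N.

Section FormalPowerSeries.
Variable A : comUnitRingType.
Implicit Types a b q : nat -> A.

(* The sequence a : nat -> A stands for the formal series \sum_n a n * z ^ n. *)
Definition fps_add a b : nat -> A := fun n => a n + b n.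
Definition fps_scale (c : A) a : nat -> A := fun n => c * a n.
Definition fps_one : nat -> A := fun n => (n == 0%N)%:R.
Definition fps_mul a b : nat -> A := fun n => \sum_(k < n.+1) a k * b (n - k)%N.

(* exp (c z); meaningful when every n`!%:R is a unit of A. *)
Definition fps_exp (c : A) : nat -> A := fun n => c ^+ n / n`!%:R.

(* Long division: the first n coefficients of a / b, for b 0 a unit. *)
Fixpoint fps_div_prefix a b (n : nat) : seq A :=
  if n is m.+1 then
    let s := fps_div_prefix a b m in
    rcons s ((a m - \sum_(k < m) s`_k * b (m - k)%N) / b 0%N)
  else [::].

Definition fps_div a b : nat -> A := fun n => (fps_div_prefix a b n.+1)`_n.

Lemma size_fps_div_prefix a b n : size (fps_div_prefix a b n) = n.
Proof. by elim: n => //= n IHn; rewrite size_rcons IHn. Qed.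

Lemma nth_fps_div_prefix a b n k :
  (k < n)%N -> (fps_div_prefix a b n)`_k = fps_div a b k.
Proof.
elim: n => // n IHn; rewrite ltnS leq_eqVlt => /predU1P[-> //|ltkn].
by rewrite /= nth_rcons size_fps_div_prefix ltkn IHn.
Qed.

Lemma fps_divE a b n :
  fps_div a b n = (a n - \sum_(k < n) fps_div a b k * b (n - k)%N) / b 0%N.
Proof.
rewrite {1}/fps_div /= nth_rcons size_fps_div_prefix ltnn eqxx.
congr ((_ - _) / _); apply: eq_bigr => k _.
by rewrite nth_fps_div_prefix.
Qed.

Lemma fps_divK a b :
  b 0%N \is a GRing.unit -> fps_mul (fps_div a b) b =1 a.
Proof.
move=> Ub n; rewrite /fps_mul big_ord_recr /= subnn fps_divE divrK //.
by rewrite addrC subrK.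
Qed.

Lemma fps_div_unique a b q :
  b 0%N \is a GRing.unit -> fps_mul q b =1 a -> q =1 fps_div a b.
Proof.
move=> Ub Eqa n; elim/ltn_ind: n => n IHn.
rewrite fps_divE -Eqa /fps_mul big_ord_recr /= subnn.
have ->: \sum_(k < n) fps_div a b k * b (n - k)%N
         = \sum_(k < n) q k * b (n - k)%N.
  by apply: eq_bigr => k _; rewrite IHn.
by rewrite addrAC subrr add0r mulrK.
Qed.

End FormalPowerSeries.

(* 2 exp (x z) / (exp z + 1), as a formal series in z over K[x], x being 'X. *)
Definition euler_gf (K : fieldType) : nat -> {poly K} :=
  fps_div (fps_scale 2%:R (fps_exp 'X))
          (fps_add (fps_exp 1) (fps_one {poly K})).

Definition euler (K : fieldType) (n : nat) : {poly K} :=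
  n`!%:R * euler_gf K n.

Section EulerGeneratingFunction.
Variable K : numFieldType.

Let polyN_unit n : (n.+1%:R : {poly K}) \is a GRing.unit.
Proof.
by rewrite -polyC_natr poly_unitE size_polyC pnatr_eq0 coefC unitfE pnatr_eq0.
Qed.

Let fact_unit n : (n`!%:R : {poly K}) \is a GRing.unit.
Proof. by rewrite -(prednK (fact_gt0 n)). Qed.

Let den0_unit :
  fps_add (fps_exp 1) (fps_one {poly K}) 0%N \is a GRing.unit.
Proof.
rewrite /fps_add /fps_exp /fps_one expr0 fact0 divr1.
exact: (polyN_unit 1).
Qed.

Lemma euler_generating :
  fps_mul (fun n => euler K n / n`!%:R)
          (fps_add (fps_exp 1) (fps_one {poly K}))
  =1 fps_scale 2%:R (fps_exp 'X).
Proof.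
move=> n; rewrite -[RHS](fps_divK _ den0_unit n); apply: eq_bigr => k _.
by rewrite /euler -/(euler_gf K) [_`!%:R * _]mulrC mulrK.
Qed.

Lemma euler_unique (E : nat -> {poly K}) :
  fps_mul (fun n => E n / n`!%:R)
          (fps_add (fps_exp 1) (fps_one {poly K}))
  =1 fps_scale 2%:R (fps_exp 'X) ->
  E =1 euler K.
Proof.
move=> /(fps_div_unique den0_unit) EE n.
by rewrite /euler /euler_gf -EE mulrC divrK.
Qed.

End EulerGeneratingFunction.

Definition sqrt5 (R : realType) : R[i] := (Num.sqrt 5%:R)%:C.
Definition alpha (R : realType) : R[i] := (1 + sqrt5 R) / 2%:R.
Definition beta (R : realType) : R[i] := (1 - sqrt5 R) / 2%:R.

(* Main.v *)
Require Import Defs.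
From HB Require Import structures.
From mathcomp Require Import all_boot all_order all_algebra.
From mathcomp Require Import reals complex.
From mathcomp Require Import ring.
Set Implicit Arguments.
Unset Strict Implicit.
Unset Printing Implicit Defensive.
Import Order.TTheory GRing.Theory Num.Theory.
Local Open Scope ring_scope.
Local Open Scope complex_scope.

(** Put [a = alpha ^ j] and [b = beta ^ j], so that [L_(jk) = a ^ k + b ^ k] and
    [sqrt5 * F_j = a - b].  Dividing by [n!], the first left-hand side is the
    coefficient of [z ^ n] in
    [(e^(az) + e^(bz)) * 2 e^(x(a-b)z) / (e^((a-b)z) + 1) = 2 e^((b + x(a-b))z)],
    and [b = beta F_j + F_(j-1)].  Exchanging [a] and [b] gives the second
    identity. *)

Section FormalPowerSeriesTheory.
Variable A : comUnitRingType.
Implicit Types (a b c : nat -> A) (s t : A).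

Lemma eq_fps_mul a a' b b' :
  a =1 a' -> b =1 b' -> fps_mul a b =1 fps_mul a' b'.
Proof. by move=> Ea Eb n; apply: eq_bigr => k _; rewrite Ea Eb. Qed.

(** Coefficient [n] of a product involves only coefficients of index at most [n], so truncated
    polynomials compute it. Commutativity and associativity are thus inherited from [{poly A}]. *)
Lemma fps_mul_coef a b N n : (n < N)%N ->
  fps_mul a b n = ((\poly_(i < N) a i) * (\poly_(i < N) b i))`_n.
Proof.
move=> ltnN; rewrite coefM; apply: eq_bigr => k _.
rewrite !coef_poly (leq_ltn_trans (leq_subr _ _) ltnN).
by rewrite (leq_ltn_trans (leq_ord k) ltnN).
Qed.

Lemma fps_mulC a b : fps_mul a b =1 fps_mul b a.
Proof. by move=> n; rewrite !(fps_mul_coef _ _ (ltnSn n)) mulrC. Qed.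

Lemma fps_mulA a b c : fps_mul a (fps_mul b c) =1 fps_mul (fps_mul a b) c.
Proof.
move=> n; pose P u := \poly_(i < n.+1) (u i : A).
(* One truncation order serves both levels: the inner products are read only at indices at most
   [n]. *)
transitivity ((P a * (P b * P c))`_n); last rewrite mulrA.
all: rewrite coefM; apply: eq_bigr => k _.
  rewrite coef_poly ltn_ord; congr (_ * _).
  by apply: fps_mul_coef; rewrite ltnS leq_subr.
rewrite coef_poly ltnS leq_subr; congr (_ * _).
by rewrite -fps_mul_coef.
Qed.

Lemma fps_mulDr a b c :
  fps_mul a (fps_add b c) =1 fps_add (fps_mul a b) (fps_mul a c).
Proof.
by move=> n; rewrite /fps_add -big_split; apply: eq_bigr => k _; rewrite mulrDr.
Qed.

Lemma fps_mul1 a : fps_mul a (fps_one A) =1 a.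
Proof.
move=> n; rewrite /fps_mul big_ord_recr /= subnn mulr1 big1 ?add0r // => k _.
by rewrite /fps_one subn_eq0 leqNgt ltn_ord mulr0.
Qed.

Lemma fps_mulZr s a b :
  fps_mul a (fps_scale s b) =1 fps_scale s (fps_mul a b).
Proof.
by move=> n; rewrite /fps_scale mulr_sumr; apply: eq_bigr => k _; rewrite mulrCA.
Qed.

(** The substitution of [s z] for [z]. *)
Definition fps_dilate s a : nat -> A := fun n => s ^+ n * a n.

Lemma fps_dilate_mul s a b :
  fps_dilate s (fps_mul a b) =1 fps_mul (fps_dilate s a) (fps_dilate s b).
Proof.
move=> n; rewrite /fps_dilate mulr_sumr; apply: eq_bigr => k _.
by rewrite -{1}(subnKC (leq_ord k)) exprD mulrACA.
Qed.

End FormalPowerSeriesTheory.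

Section Exponential.
Variable K : numFieldType.
Implicit Types a b s t x : K.

Lemma fact_neq0 n : n`!%:R != 0 :> K.
Proof. by rewrite pnatr_eq0 -lt0n fact_gt0. Qed.

Lemma binomialE n k : (k <= n)%N ->
  'C(n, k)%:R = n`!%:R / (k`!%:R * (n - k)`!%:R) :> K.
Proof.
move=> lekn; rewrite -(bin_fact lekn) !natrM mulfK //.
by rewrite mulf_neq0 ?fact_neq0.
Qed.

(** Bridge between products of exponential generating functions and the binomial sums of the
    theorem. *)
Lemma fps_mul_divfact (u v : nat -> K) n :
  n`!%:R * fps_mul (fun k => u k / k`!%:R) (fun k => v k / k`!%:R) n
  = \sum_(k < n.+1) 'C(n, k)%:R * u k * v (n - k)%N.
Proof.
rewrite mulr_sumr; apply: eq_bigr => k _; rewrite binomialE ?leq_ord //.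
by rewrite invfM; ring.
Qed.

Lemma fps_expD s t : fps_mul (fps_exp s) (fps_exp t) =1 fps_exp (s + t).
Proof.
move=> n; apply: (mulfI (fact_neq0 n)).
(* With [n!] cleared, the claim is the binomial theorem. *)
rewrite fps_mul_divfact mulrC divfK ?fact_neq0 // addrC exprDn.
by apply: eq_bigr => k _; rewrite -mulr_natl; ring.
Qed.

Lemma fps_dilate_exp s t : fps_dilate s (fps_exp t) =1 fps_exp (s * t).
Proof. by move=> n; rewrite /fps_dilate /fps_exp exprMn mulrA. Qed.

Lemma horner_divfact (p : {poly K}) n x :
  (p / n`!%:R).[x] = p.[x] / n`!%:R.
Proof.
have -> : (n`!%:R : {poly K})^-1 = (n`!%:R^-1)%:P by rewrite -polyCV polyC_natr.
by rewrite hornerM hornerC.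
Qed.

(** Evaluation at [x] is a ring morphism, so it carries the defining identity from [{poly K}] to [K]
    coefficient by coefficient. *)
Lemma euler_generating_at x :
  fps_mul (fun n => (euler K n).[x] / n`!%:R)
          (fps_add (fps_exp 1) (fps_one K))
  =1 fps_scale 2%:R (fps_exp x).
Proof.
move=> n; have /(congr1 (horner_eval x)) := euler_generating K n.
rewrite /fps_mul raddf_sum /fps_scale /horner_eval /= hornerM horner_divfact.
rewrite horner_exp hornerX -polyC_natr hornerC => <-; apply: eq_bigr => k _.
rewrite /fps_add /fps_exp /fps_one /horner_eval [RHS]hornerM hornerD !horner_divfact !expr1n.
by rewrite -(polyC_natr K (_ == _)) -polyC1 !hornerC.
Qed.

Lemma euler_binomial_sum a b x n :
  \sum_(k < n.+1) 'C(n, k)%:R * (a ^+ k + b ^+ k) * (a - b) ^+ (n - k)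
     * (euler K (n - k)).[x]
  = 2%:R * (b + (a - b) * x) ^+ n.
Proof.
pose e k := (euler K k).[x] / k`!%:R; pose d := a - b.
have dE : fps_mul (fps_dilate d e) (fps_add (fps_exp d) (fps_one K))
          =1 fps_scale 2%:R (fps_exp (d * x)).
  move=> m; transitivity (fps_dilate d (fps_scale 2%:R (fps_exp x)) m).
    rewrite /fps_dilate -euler_generating_at -/(fps_dilate _ _ m).
    rewrite [RHS]fps_dilate_mul; apply: eq_fps_mul => // k.
    rewrite /fps_dilate /fps_add mulrDr -/(fps_dilate _ _ k) fps_dilate_exp mulr1.
    (* Dilation fixes the series 1, whose only nonzero coefficient is multiplied by [d ^+ 0]. *)
    by case: k => [|k]; rewrite /fps_one ?mulr1 ?mulr0 ?expr0 ?mul1r.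
  by rewrite /fps_dilate /fps_scale mulrCA -/(fps_dilate _ _ m) fps_dilate_exp.
have abE : fps_mul (fps_exp b) (fps_add (fps_exp d) (fps_one K))
           =1 fps_add (fps_exp a) (fps_exp b).
  by move=> m; rewrite fps_mulDr /fps_add fps_expD fps_mul1 /d [b + _]addrC subrK.
have: fps_mul (fps_add (fps_exp a) (fps_exp b)) (fps_dilate d e) n
      = fps_scale 2%:R (fps_exp (b + d * x)) n.
  (* By [abE], the left factor contains e^(dz) + 1; associativity hands it over to the dilated Euler
     series, where [dE] absorbs it. No division by it takes place. *)
  transitivity (fps_mul (fps_exp b) (fps_scale 2%:R (fps_exp (d * x))) n).
    rewrite -(eq_fps_mul abE (frefl _)) -fps_mulA; apply: eq_fps_mul => // m.
    by rewrite fps_mulC dE.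
  by rewrite fps_mulZr /fps_scale fps_expD.
move=> /(congr1 ( *%R n`!%:R)); rewrite /fps_scale /fps_exp.
rewrite [_ * (2%:R * _)]mulrCA [_ * (_ / _)]mulrC divfK ?fact_neq0 // => <-.
under eq_bigr do rewrite -mulrA.
rewrite -[LHS](fps_mul_divfact (fun k => a ^+ k + b ^+ k)
                               (fun k => d ^+ k * (euler K k).[x])).
congr (_ * _); apply: eq_fps_mul => k.
  by rewrite /fps_add mulrDl.
by rewrite /fps_dilate /e mulrA.
Qed.

End Exponential.

Lemma nat_ind2 (P : nat -> Prop) :
  P 0%N -> P 1%N -> (forall n, P n -> P n.+1 -> P n.+2) -> forall n, P n.
Proof.
move=> P0 P1 PS n; suff [] : P n /\ P n.+1 by [].
by elim: n => // n [Pn Pn1]; split=> //; apply: PS.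
Qed.

Lemma fibSS n : fib n.+2 = (fib n.+1 + fib n)%N. Proof. by []. Qed.
Lemma lucasSS n : lucas n.+2 = (lucas n.+1 + lucas n)%N. Proof. by []. Qed.

Section Binet.
Variable K : comNzRingType.

(** Multiplying by [g] and reducing g^2 to g + 1 reproduces the Fibonacci recurrence on the
    coefficients. Starting from exponent 1 keeps the index of the constant term natural. *)
Lemma golden_exp (g : K) n :
  g ^+ 2 = g + 1 -> g ^+ n.+1 = g * (fib n.+1)%:R + (fib n)%:R.
Proof.
move=> g2; elim: n => [|n IHn]; first by rewrite expr1 mulr1 addr0.
rewrite exprS IHn fibSS natrD mulrDr mulrA -expr2 g2; ring.
Qed.

(** Both sides obey the same second-order recurrence; [g + h = 1] supplies the value at index 1. *)
Lemma lucas_binet (g h : K) n : g ^+ 2 = g + 1 -> h ^+ 2 = h + 1 ->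
  g + h = 1 -> (lucas n)%:R = g ^+ n + h ^+ n.
Proof.
move=> g2 h2 gh; elim/nat_ind2: n => [||n IH0 IH1].
- by rewrite !expr0.
- by rewrite !expr1 gh.
rewrite lucasSS natrD IH0 IH1 -(addn2 n) -(addn1 n) !exprD g2 h2 !expr1; ring.
Qed.

End Binet.

Section GoldenRatio.
Variable R : realType.

Lemma sqrt5_sqr : sqrt5 R ^+ 2 = 5%:R.
Proof. by rewrite /sqrt5 -rmorphXn /= sqr_sqrtr ?ler0n // rmorph_nat. Qed.

Lemma alpha_sqr : alpha R ^+ 2 = alpha R + 1.
Proof.
(* The factor 4 clears the squared denominator of [alpha] and isolates the square of [sqrt5 R]. *)
apply: (mulfI (_ : 4%:R != 0)); first by rewrite pnatr_eq0.
have -> : 4%:R * alpha R ^+ 2 = 1 + 2%:R * sqrt5 R + sqrt5 R ^+ 2.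
  by rewrite /alpha; field.
by rewrite sqrt5_sqr /alpha; field.
Qed.

Lemma alphaDbeta : alpha R + beta R = 1.
Proof. by rewrite /alpha /beta; field. Qed.

Lemma alphaBbeta : alpha R - beta R = sqrt5 R.
Proof. by rewrite /alpha /beta; field. Qed.

Lemma beta_sqr : beta R ^+ 2 = beta R + 1.
Proof.
have -> : beta R = 1 - alpha R by rewrite -alphaDbeta addrC addKr.
by rewrite sqrrB alpha_sqr; ring.
Qed.

End GoldenRatio.

Theorem theorem7 (R : realType) (n j : nat) (hj : (1 <= j)%N) (x : R[i]) :
  \sum_(k < n.+1)
     'C(n, k)%:R * (lucas (j * k))%:R * (sqrt5 R * (fib j)%:R) ^+ (n - k)
       * (euler R[i] (n - k)).[x]
    = 2%:R * ((sqrt5 R * x + beta R) * (fib j)%:R + (fib j.-1)%:R) ^+ n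
  /\
  \sum_(k < n.+1)
     'C(n, k)%:R * (lucas (j * k))%:R * (- sqrt5 R * (fib j)%:R) ^+ (n - k)
       * (euler R[i] (n - k)).[x]
    = 2%:R * ((alpha R - sqrt5 R * x) * (fib j)%:R + (fib j.-1)%:R) ^+ n.
Proof.
case: j hj => // j _; rewrite [j.+1.-1]/=.
have aE := golden_exp j (alpha_sqr R); have bE := golden_exp j (beta_sqr R).
have dE : sqrt5 R * (fib j.+1)%:R = alpha R ^+ j.+1 - beta R ^+ j.+1.
  by rewrite aE bE -alphaBbeta; ring.
have LE k : (lucas (j.+1 * k))%:R
            = (alpha R ^+ j.+1) ^+ k + (beta R ^+ j.+1) ^+ k :> R[i].
  rewrite -!exprM.
  exact: lucas_binet (alpha_sqr R) (beta_sqr R) (alphaDbeta R).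
split.
  under eq_bigr do rewrite LE dE.
  rewrite euler_binomial_sum -dE bE; congr (_ * _ ^+ _); ring.
(* The sign change turns a - b into b - a, and [addrC] swaps the Lucas terms to match:
   [euler_binomial_sum] applies with the two powers exchanged. *)
under eq_bigr do rewrite LE addrC mulNr dE opprB.
rewrite euler_binomial_sum -opprB -dE aE; congr (_ * _ ^+ _); ring.
Qed.
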